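(* The signed poset $Y_\alpha=(Y,s_\alpha,a')$ is $\alpha$-signed differential, and the signed poset $Y_\beta=(Y,s_\beta,a')$ is $\beta$-signed differential.
   Context: $K$ is a field of characteristic $0$. For a graded poset $P=\bigcup_{n\ge0}P_n$ with finitely many elements of each rank and a minimum $\hat 0\in P_0$, $x\lessdot y$ means $y$ covers $x$; $\hat KP$ is the $K$-vector space of arbitrary (possibly infinite) $K$-linear combinations of elements of $P$, and $\mathbf P=\sum_{x\in P}x\in\hat KP$. A linear map $\hat KP\to\hat KP$ is continuous if it preserves infinite linear combinations. A signing of $P$ is a pair $(s,v)$ where $s$ assigns a sign $s(x\lessdot y)\in\{\pm1\}$ to every cover relation and $v:P\to\{\pm1\}$; $(P,s,v)$ is then called a signed poset. Define continuous linear operators on $\hat KP$ by $$Ux=\sum_{y:\,x\lessdot y}s(x\lessdot y)\,y,\qquad Dx=\sum_{y:\,y\lessdot x}s(y\lessdot x)\,v(x)\,v(y)\,y\qquad(x\in P).$$ $(P,s,v)$ is weakly signed differential if $v(\hat 0)=1$ and $UD+DU=I$. It is $\alpha$-signed differential if in addition $(U+D)\mathbf P=\mathbf P$, and $\beta$-signed differential if instead in addition $(D-U)\mathbf P=\mathbf P$. $Y$ is Young's lattice: the poset of all integer partitions $\lambda=(\lambda_1\ge\lambda_2\ge\cdots)$ ordered by inclusion of Young diagrams (English notation), graded by $|\lambda|=\lambda_1+\lambda_2+\cdots$, with minimum $\emptyset$; $\lambda\lessdot\mu$ iff the diagram of $\mu$ is obtained from that of $\lambda$ by adding one box. $\lambda'$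 is the conjugate partition. Put $$a(\lambda)=(-1)^{\lambda_2+\lambda_4+\cdots},\qquad a'(\lambda)=a(\lambda')=(-1)^{\lambda'_2+\lambda'_4+\cdots},\qquad a(\mu/\lambda)=a(\lambda)a(\mu).$$ For a cover $\lambda\lessdot\mu$ whose added box lies in row $i$, put $$s_\alpha(\lambda\lessdot\mu)=(-1)^{\lambda_1+\lambda_2+\cdots+\lambda_i},\qquad s_\beta(\lambda\lessdot\mu)=a(\mu/\lambda)\,s_\alpha(\lambda\lessdot\mu).$$ *)

(* Defs.v *)
From HB Require Import structures.
From mathcomp Require Import all_boot all_order all_algebra.
From mathcomp Require Import finmap boolp classical_sets functions cardinality fsbigop.
From mathcomp Require Import zify.

Set Implicit Arguments.
Unset Strict Implicit.
Unset Printing Implicit Defensive.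

Import Order.TTheory GRing.Theory Num.Theory.
Local Open Scope classical_set_scope.
Local Open Scope ring_scope.

Definition covers {d} {P : porderType d} (x y : P) : Prop :=
  (x < y)%O /\ forall z : P, ~~ ((x < z)%O && (z < y)%O).

Notation "x ⋖ y" := (covers x y) (at level 70, no associativity).

HB.mixin Record isGradedPoset d P of Order.BPOrder d P := {
  rank : P -> nat;
  rank_bot : rank \bot%O = 0%N;
  rank_lt : forall x y : P, (x < y)%O -> (rank x < rank y)%N;
  rank_covers : forall x y : P, x ⋖ y -> rank y = (rank x).+1;
  finite_rank : forall n, finite_set [set x : P | rank x = n]
}.

#[short(type="gradedPosetType")]
HB.structure Definition GradedPoset d :=
  { P of isGradedPoset d P & Order.BPOrder d P }.

(* [sgn_cover] is total, but only its values on cover relations matter. *)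
Record signing d (P : gradedPosetType d) := Signing {
  sgn_cover : P -> P -> int;
  sgn_elt : P -> int;
  sgn_coverP : forall x y, x ⋖ y -> sgn_cover x y = 1 \/ sgn_cover x y = -1;
  sgn_eltP : forall x, sgn_elt x = 1 \/ sgn_elt x = -1
}.

(* An infinite linear combination of elements of [P] is its family of
   coefficients; [K^o] is [K] as a module over itself, so that [hat K P] is a
   [K]-module for the pointwise operations. *)
Notation hat K P := (P -> K^o).

Section Hat.
Variables (K : fieldType) (d : Order.disp_t) (P : gradedPosetType d).

Definition basis (x : P) : hat K P := fun z => (x == z)%:R.

(* The sum [\sum_(x in P) x] of all the elements. *)
Definition allsum : hat K P := fun=> 1.

(* Infinite combinations make sense for families in which every element of [P]
   occurs finitely often; [\sum_(i \in _)] is the finitely supported sum. *)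
Definition summable (I : choiceType) (g : I -> hat K P) : Prop :=
  forall z, finite_set [set i | g i z != 0].

Definition infcomb (I : choiceType) (c : I -> K) (g : I -> hat K P) : hat K P :=
  fun z => \sum_(i \in [set: I]) c i * g i z.

Definition continuous_op (T : hat K P -> hat K P) : Prop :=
  forall (I : choiceType) (c : I -> K) (g : I -> hat K P), summable g ->
    summable (T \o g) /\ T (infcomb c g) = infcomb c (T \o g).

Variable S : signing P.
Local Notation s := (sgn_cover S).
Local Notation v := (sgn_elt S).

Definition up_basis (x : P) : hat K P :=
  \sum_(y \in [set y | x ⋖ y]) (s x y)%:~R *: basis y.

Definition down_basis (x : P) : hat K P :=
  \sum_(y \in [set y | y ⋖ x]) (s y x * v x * v y)%:~R *: basis y.

(* The continuous extensions of [up_basis] and [down_basis]. *)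
Definition up (f : hat K P) : hat K P := infcomb f up_basis.
Definition down (f : hat K P) : hat K P := infcomb f down_basis.

Definition weakly_signed_differential : Prop :=
  v \bot%O = 1 /\ forall f : hat K P, up (down f) + down (up f) = f.

Definition alpha_signed_differential : Prop :=
  weakly_signed_differential /\ up allsum + down allsum = allsum.

Definition beta_signed_differential : Prop :=
  weakly_signed_differential /\ down allsum - up allsum = allsum.

End Hat.

Arguments basis K {d P} x.
Arguments allsum K {d} P.
Arguments up_basis K {d P} S x.
Arguments down_basis K {d P} S x.
Arguments up {K d P} S f.
Arguments down {K d P} S f.
Arguments weakly_signed_differential K {d P} S.
Arguments alpha_signed_differential K {d P} S.
Arguments beta_signed_differential K {d P} S.

Section HatTheory.
Variables (K : fieldType) (d : Order.disp_t) (P : gradedPosetType d).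

Lemma finite_covers (x : P) : finite_set [set y | x ⋖ y].
Proof.
by apply: sub_finite_set (finite_rank (rank x).+1) => y /= /rank_covers.
Qed.

Lemma finite_cocovers (x : P) : finite_set [set y | y ⋖ x].
Proof.
apply: sub_finite_set (finite_rank (rank x).-1) => y /= /rank_covers ->.
by [].
Qed.

Lemma fsum_basisE (A : set P) (c : P -> K) z : finite_set A ->
  (\sum_(y \in A) c y *: basis K y) z = if `[< A z >] then c z else 0.
Proof.
move=> finA; rewrite fsbig_finite //= fct_sumE.
have cE y : (c y *: basis K y) z = if y == z then c y else 0.
  by rewrite /basis /GRing.scale /= /GRing.scale /=; case: eqP => _;
    rewrite ?mulr1 ?mulr0.
rewrite (eq_bigr _ (fun y _ => cE y)); case: asboolP => [Az|nAz].
  rewrite (bigD1_seq z) ?fset_uniq ?in_fset_set ?inE //= eqxx.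
  by rewrite big1 ?addr0 // => y /negPf ->.
rewrite big1_seq // => y /=; rewrite in_fset_set // inE => Ay.
by case: eqP => // yz; rewrite yz in Ay.
Qed.

Lemma infcomb_basis (f : hat K P) : infcomb f (basis K) = f.
Proof.
apply/funext => z; rewrite /infcomb -(fsbig_widen [set z]) //.
  by rewrite fsbig_set1 /basis eqxx mulr1.
by move=> x [_ /eqP/negPf xz] /=; rewrite /basis xz mulr0.
Qed.

Lemma infcomb_op_basis (B : P -> hat K P) x : infcomb (basis K x) B = B x.
Proof.
apply/funext => z; rewrite /infcomb -(fsbig_widen [set x]) //.
  by rewrite fsbig_set1 /basis eqxx mul1r.
by move=> y [_ /eqP/negPf yx] /=; rewrite /basis eq_sym yx mul0r.
Qed.

Lemma infcomb_continuous (B : P -> hat K P) :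
  summable B -> continuous_op (fun f => infcomb f B).
Proof.
move=> finB I c g fing.
pose J z := \bigcup_(x in [set x | B x z != 0]) [set i | g i x != 0].
have finJ z : finite_set (J z) by apply: bigcup_finite.
have infE (f : hat K P) z :
    infcomb f B z = \sum_(x \in [set x | B x z != 0]) f x * B x z.
  apply/esym/fsbig_widen => // x [_ /=] /negP.
  by rewrite negbK => /eqP ->; rewrite mulr0.
have J0 z i : ~ J z i -> infcomb (g i) B z = 0.
  move=> nJ; rewrite infE fsbig1 // => x Bx.
  have [-> | gx] := eqVneq (g i x) 0; first by rewrite mul0r.
  by case: nJ; exists x.
split=> [z|].
  apply: sub_finite_set (finJ z) => i /= ; apply: contra_neqP; exact: J0.
apply/funext => z; rewrite infE /=.
transitivity (\sum_(x \in [set x | B x z != 0])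
               \sum_(i \in J z) c i * (g i x * B x z)).
  apply: eq_fsbigr => x; rewrite inE /= => Bx.
  rewrite mulr_fsuml.
  under eq_fsbigr do rewrite -mulrA.
  apply/esym/fsbig_widen => // i [_ nJ] /=.
  have [-> | gx] := eqVneq (g i x) 0; first by rewrite mul0r mulr0.
  by case: nJ; exists x.
rewrite exchange_fsbig //.
transitivity (\sum_(i \in J z) c i * infcomb (g i) B z).
  apply: eq_fsbigr => i _; rewrite infE mulr_fsumr.
  by apply: eq_fsbigr => x _.
apply: fsbig_widen => // i [_ nJ] /=.
by rewrite J0 ?mulr0.
Qed.

Variable S : signing P.

Lemma up_basisE x z :
  up_basis K S x z = if `[< x ⋖ z >] then (sgn_cover S x z)%:~R else 0.
Proof. exact: (fsum_basisE _ z (finite_covers x)). Qed.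

Lemma down_basisE x z : down_basis K S x z =
  if `[< z ⋖ x >] then (sgn_cover S z x * sgn_elt S x * sgn_elt S z)%:~R else 0.
Proof. exact: (fsum_basisE _ z (finite_cocovers x)). Qed.

Lemma up_on_basis x : up S (basis K x) = up_basis K S x.
Proof. exact: infcomb_op_basis. Qed.

Lemma down_on_basis x : down S (basis K x) = down_basis K S x.
Proof. exact: infcomb_op_basis. Qed.

Lemma up_continuous : continuous_op (up (K := K) S).
Proof.
apply: infcomb_continuous => z.
apply: sub_finite_set (finite_cocovers z) => x /=.
by rewrite up_basisE; case: asboolP => //; rewrite eqxx.
Qed.

Lemma down_continuous : continuous_op (down (K := K) S).
Proof.
apply: infcomb_continuous => z.
apply: sub_finite_set (finite_covers z) => x /=.
by rewrite down_basisE; case: asboolP => //; rewrite eqxx.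
Qed.

End HatTheory.

Local Open Scope nat_scope.

Definition is_intpart (l : seq nat) : bool := sorted geq l && (0 \notin l).

Record intpart := IntPart { parts :> seq nat; _ : is_intpart parts }.
HB.instance Definition _ := [isSub for parts].
HB.instance Definition _ := [Choice of intpart by <:].

(* Rows and columns are numbered from 0: [part l i] is the length
   [l_(i+1)] of row [i] of the diagram. *)
Definition part (l : seq nat) (i : nat) : nat := nth 0 l i.

Definition diagram (l : intpart) : set (nat * nat) :=
  [set ij | ij.2 < part l ij.1].

Definition weight (l : intpart) : nat := sumn l.

Lemma is_intpartP (l : seq nat) : reflect
  ((forall i, part l i.+1 <= part l i) /\ (forall i, i < size l -> 0 < part l i))
  (is_intpart l).
Proof.
apply: (iffP andP) => [[srt n0]|[mono pos]]; split.
- move=> i; have [lt|ge] := ltnP i.+1 (size l); last by rewrite /part nth_default.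
  exact: (sortedP 0 srt).
- move=> i lt; rewrite lt0n; apply: contraNneq n0 => <-; exact: mem_nth.
- by apply/(sortedP 0) => i _; apply: mono.
- by apply/negP => /(nthP 0)[i /pos + eq0]; rewrite /part eq0.
Qed.

Lemma intpartP (l : intpart) : is_intpart l.
Proof. exact: valP l. Qed.

Lemma part_homo (l : intpart) i j : i <= j -> part l j <= part l i.
Proof.
have /is_intpartP[mono _] := intpartP l.
move=> le_ij; rewrite -(subnKC le_ij); elim: (j - i) => [|k IH].
  by rewrite addn0.
by rewrite addnS; apply: leq_trans (mono _) IH.
Qed.

Lemma part_gt0 (l : intpart) i : (0 < part l i) = (i < size l).
Proof.
have /is_intpartP[_ pos] := intpartP l.
by have [/pos|ge] := ltnP i (size l); rewrite // /part nth_default.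
Qed.

Lemma intpart_eq (l m : intpart) : part l =1 part m -> l = m.
Proof.
move=> eqp; apply: val_inj; apply: (@eq_from_nth _ 0) => [|i _]; last exact: eqp.
apply/eqP; rewrite eqn_leq; apply/andP; split; rewrite leqNgt -part_gt0;
  [rewrite eqp | rewrite -eqp]; by rewrite part_gt0 ltnn.
Qed.

Lemma sumn_part (l : seq nat) n : size l <= n -> sumn l = \sum_(i < n) part l i.
Proof.
move=> le; rewrite -(big_mkord xpredT (part l)) (big_cat_nat (n := size l)) //=.
rewrite [X in _ + X]big_nat_cond [X in _ + X]big1 ?addn0.
  by rewrite sumnE (big_nth 0).
by move=> i /andP[/andP[ge _] _]; rewrite /part nth_default.
Qed.

Fact empty_subproof : is_intpart [::]. Proof. by []. Qed.
Definition empty_intpart : intpart := IntPart empty_subproof.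

Definition young_le (l m : intpart) : bool := `[< diagram l `<=` diagram m >].

Lemma young_leP (l m : intpart) :
  reflect (forall i, part l i <= part m i) (young_le l m).
Proof.
apply: (iffP (asboolP _)) => [sub i|le [i j] /= lt].
  rewrite leqNgt; apply/negP => lt.
  by have := sub (i, part m i) lt; rewrite /diagram /= ltnn.
exact: leq_trans lt (le i).
Qed.

Fact young_le_refl : reflexive young_le.
Proof. by move=> l; apply/asboolP. Qed.
Fact young_le_anti : antisymmetric young_le.
Proof.
move=> l m /andP[/young_leP lm /young_leP ml]; apply: intpart_eq => i.
by apply/eqP; rewrite eqn_leq lm ml.
Qed.
Fact young_le_trans : transitive young_le.
Proof.
move=> m l n /asboolP lm /asboolP mn; apply/asboolP; exact: subset_trans lm mn.
Qed.

Fact young_display : Order.disp_t. Proof. exact: (Order.Disp tt tt). Qed.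

HB.instance Definition _ := Order.Le_isPOrder.Build young_display intpart
  young_le_refl young_le_anti young_le_trans.

Fact young_le0 (l : intpart) : (empty_intpart <= l)%O.
Proof. by apply/young_leP => i; rewrite /part nth_nil. Qed.
HB.instance Definition _ := Order.hasBottom.Build young_display intpart young_le0.

Fact weight_bot : weight \bot%O = 0. Proof. by []. Qed.

Lemma weight_lt (l m : intpart) : (l < m)%O -> weight l < weight m.
Proof.
rewrite lt_neqAle => /andP[ne /young_leP le].
pose n := maxn (size l) (size m).
rewrite /weight (@sumn_part l n) ?leq_maxl // (@sumn_part m n) ?leq_maxr //.
rewrite ltn_neqAle leq_sum ?andbT => [|i _]; last exact: le.
apply: contra ne => /eqP eqs; apply/eqP/intpart_eq => i.
have [lt|ge] := ltnP i n; last first.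
  by move: ge; rewrite geq_max => /andP[gl gm]; rewrite /part !nth_default.
have [_] := @leqif_sum 'I_n xpredT _ _ _ (fun i _ => leqif_eq (le i)).
by rewrite eqs eqxx => /esym/forallP/(_ (Ordinal lt))/eqP.
Qed.

(* Row [i] (numbered from 0) in which [m] has its first box not in [l]. *)
Definition added_row (l m : intpart) : nat :=
  find (fun i => part l i != part m i) (iota 0 (size m)).

Lemma added_row_lt (l m : intpart) : (l < m)%O ->
  part l (added_row l m) < part m (added_row l m) /\
  forall i, i < added_row l m -> part l i = part m i.
Proof.
rewrite lt_neqAle => /andP[ne /young_leP le].
have hs : has (fun i => part l i != part m i) (iota 0 (size m)).
  apply: contraNT ne => /hasPn eqp; apply/eqP/intpart_eq => i.
  have [lt|ge] := ltnP i (size m).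
    by apply/eqP; rewrite -[_ == _]negbK; apply: eqp; rewrite mem_iota.
  by apply/eqP; rewrite eqn_leq le /= {1}/part nth_default.
have lts : added_row l m < size m by move: hs; rewrite has_find size_iota.
split.
  have := nth_find 0 hs; rewrite -/(added_row l m) nth_iota // add0n => neq.
  by rewrite ltn_neqAle neq le.
move=> i lti; have := before_find 0 lti.
by rewrite nth_iota ?(ltn_trans lti) // add0n => /negbFE/eqP.
Qed.

Lemma part_incr (l : seq nat) i j : part (incr_nth l i) j = (i == j) + part l j.
Proof. by rewrite /part nth_incr_nth. Qed.

Lemma young_lt_incr (l m : intpart) : (l < m)%O ->
  exists n : intpart,
    parts n = incr_nth l (added_row l m) /\ ((l < n)%O /\ (n <= m)%O).
Proof.
move=> lm; have [lti eqi] := added_row_lt lm; set i := added_row l m in lti eqi *.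
have /young_leP le := ltW lm.
have mono k : part (incr_nth l i) k.+1 <= part (incr_nth l i) k.
  rewrite !part_incr; have := part_homo l (leqnSn k).
  case: (eqVneq i k.+1) => [ik|_]; last by case: (i == k); lia.
  move=> _; have ltk : k < i by rewrite ik.
  have := part_homo m (leqnSn k); rewrite (eqi _ ltk) -ik.
  by move: lti; case: (i == k); lia.
have pos k : k < size (incr_nth l i) -> 0 < part (incr_nth l i) k.
  rewrite size_incr_nth part_incr; case: (ltnP i (size l)) => [_|ge] ltk.
    by rewrite addn_gt0 part_gt0 ltk orbT.
  case: (ltngtP k i) => [lt|gt|->]; last by rewrite ?eqxx.
    rewrite addn_gt0; apply/orP; right; rewrite eqi // part_gt0.
    rewrite (leq_trans lt) // ltnW // -part_gt0.
    by apply: leq_ltn_trans lti.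
  by lia.
have ip : is_intpart (incr_nth l i) by apply/is_intpartP.
exists (IntPart ip); split=> //; split; last first.
  apply/young_leP => k; rewrite part_incr; case: eqVneq => [<-|_]; first exact: lti.
  exact: le.
rewrite lt_neqAle; apply/andP; split.
  apply/eqP => /(congr1 (fun l : intpart => part l i)) /=.
  by rewrite part_incr eqxx; lia.
by apply/young_leP => k; rewrite part_incr leq_addl.
Qed.

Lemma covers_added_row (l m : intpart) :
  l ⋖ m -> parts m = incr_nth l (added_row l m).
Proof.
move=> [lm nobetween]; have [n [<- [ln nm]]] := young_lt_incr lm.
have := nobetween n; rewrite ln /= lt_neqAle nm andbT negbK.
by move=> /eqP ->.
Qed.

Lemma weight_incr (l m : intpart) i :
  parts m = incr_nth l i -> weight m = (weight l).+1.
Proof.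
rewrite /weight => ->; elim: (parts l) i => [|x s IH] [|i] //=.
  by elim: i => //= i; rewrite sumn_ncons mul0n.
by rewrite IH addnS.
Qed.

Lemma weight_covers (l m : intpart) : l ⋖ m -> weight m = (weight l).+1.
Proof. by move/covers_added_row/weight_incr. Qed.

Lemma young_coversP (l m : intpart) :
  l ⋖ m <-> exists i, parts m = incr_nth l i.
Proof.
split=> [/covers_added_row|[i mE]]; first by exists (added_row l m).
have wE := weight_incr mE; split.
  rewrite lt_neqAle; apply/andP; split.
    by apply/eqP => lm; move: wE; rewrite lm; lia.
  by apply/young_leP => k; rewrite mE part_incr leq_addl.
move=> n; apply/negP => /andP[/weight_lt ln /weight_lt nm].
by move: ln nm; rewrite wE; lia.
Qed.

Lemma finite_weight n : finite_set [set l : intpart | weight l = n].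
Proof.
pose g (t : {ffun 'I_n -> 'I_n.+1}) : intpart :=
  insubd empty_intpart [seq x <- [seq val (t i) | i <- enum 'I_n] | x != 0].
apply: sub_finite_set (finite_image g (@finite_finset _ setT)) => l /= wl.
have lel i : part l i <= n.
  rewrite -wl /weight (@sumn_part l (maxn (size l) i.+1)) ?leq_maxl //.
  have lt : i < maxn (size l) i.+1 by rewrite leq_max leqnn orbT.
  by rewrite (bigD1 (Ordinal lt)) //= leq_addr.
have les : size l <= n.
  rewrite -wl /weight (@sumn_part l (size l)) // -{1}[size l]card_ord -sum1_card.
  by apply: leq_sum => i _; rewrite part_gt0.
exists [ffun i : 'I_n => inord (part l i)] => //; apply: val_inj.
rewrite /g val_insubd.
have -> : [seq x <- [seq val ([ffun i : 'I_n => inord (part l i) : 'I_n.+1] i)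
             | i <- enum 'I_n] | x != 0] = l.
  under eq_map do rewrite ffunE /= inordK ?ltnS ?lel //.
  rewrite (map_comp (part l) val) val_enum_ord -(subnKC les) iotaD map_cat.
  rewrite filter_cat add0n [X in _ ++ X](_ : _ = [::]) ?cats0.
    have -> : [seq part l i | i <- iota 0 (size l)] = l.
      by rewrite -[RHS](mkseq_nth 0).
    apply/all_filterP/allP => x xl; have /andP[_] := intpartP l.
    by apply: contraNneq => <-.
  apply/eqP; rewrite -size_eq0 size_filter -leqn0 leqNgt -has_count.
  apply/hasPn => x /mapP[i]; rewrite mem_iota => /andP[ge _] ->.
  by rewrite negbK /part nth_default.
by rewrite intpartP.
Qed.

HB.instance Definition _ := isGradedPoset.Build young_display intpart
  weight_bot weight_lt weight_covers finite_weight.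

Definition conj_parts (l : seq nat) : seq nat :=
  mkseq (fun j => count (ltn j) l) (head 0 l).

Lemma part_conj (l : intpart) j : part (conj_parts l) j = count (ltn j) l.
Proof.
have [lt|ge] := ltnP j (head 0 l); first by rewrite /part nth_mkseq.
rewrite /part nth_default ?size_mkseq //; apply/esym/eqP.
rewrite -leqn0 leqNgt -has_count; apply/hasPn => x /(nthP 0)[i _ <-].
rewrite /= -leqNgt; apply: leq_trans ge; rewrite -nth0.
exact: (part_homo l (leq0n i)).
Qed.

Fact conj_subproof (l : intpart) : is_intpart (conj_parts l).
Proof.
apply/is_intpartP; split=> i; rewrite part_conj ?part_conj.
  by apply: sub_count => x /=; apply: ltnW.
rewrite size_mkseq -has_count => lt; apply/hasP; exists (head 0 l) => //.
by case: (parts l) lt => //= x s _; rewrite mem_head.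
Qed.

Definition conjugate (l : intpart) : intpart := IntPart (conj_subproof l).

Lemma diagram_conjugate (l : intpart) i j :
  diagram (conjugate l) (i, j) <-> diagram l (j, i).
Proof.
rewrite /diagram /= part_conj.
have cE : count (ltn i) l = count (fun k => i < part l k) (iota 0 (size l)).
  by rewrite -{1}[parts l](mkseq_nth 0) /mkseq count_map.
have le k : i < part l k -> k < size l by rewrite -part_gt0; case: part.
split=> [lt|lt].
  apply/negP => /negP; rewrite -leqNgt => ge; move: lt; apply/negP; rewrite -leqNgt cE.
  rewrite -[X in _ <= X](size_iota 0) -size_filter uniq_leq_size ?filter_uniq ?iota_uniq //.
  move=> k; rewrite mem_filter !mem_iota /= add0n => /andP[ltk _].
  rewrite ltnNge; apply/negP => /(part_homo l) lekj.
  by have := leq_trans ltk (leq_trans lekj ge); rewrite ltnn.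
rewrite cE -[X in X <= _](size_iota 0) -size_filter uniq_leq_size ?iota_uniq //.
move=> k; rewrite mem_filter !mem_iota /= add0n ltnS => lek.
have ltk := leq_trans lt (part_homo l lek).
by rewrite ltk (le _ ltk).
Qed.

Local Open Scope ring_scope.

(* The parts of even index are those in the 0-based rows of odd index. *)
Definition a_sign (l : intpart) : int :=
  (-1) ^+ (\sum_(i < size l | odd i) part l i)%N.

Definition a'_sign (l : intpart) : int := a_sign (conjugate l).

Definition s_alpha (l m : intpart) : int :=
  (-1) ^+ (\sum_(j < (added_row l m).+1) part l j)%N.

Definition s_beta (l m : intpart) : int := a_sign l * a_sign m * s_alpha l m.

Lemma exprN1_int n : (-1) ^+ n = 1 :> int \/ (-1) ^+ n = -1 :> int.
Proof. by rewrite -signr_odd; case: (odd n); [right|left]. Qed.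

Fact a'_signP l : a'_sign l = 1 \/ a'_sign l = -1.
Proof. exact: exprN1_int. Qed.

Fact s_alphaP (l m : intpart) : l ⋖ m -> s_alpha l m = 1 \/ s_alpha l m = -1.
Proof. by move=> _; apply: exprN1_int. Qed.

Fact s_betaP (l m : intpart) : l ⋖ m -> s_beta l m = 1 \/ s_beta l m = -1.
Proof. by move=> _; rewrite /s_beta -!exprD; apply: exprN1_int. Qed.

Definition Y_alpha : signing intpart := Signing s_alphaP a'_signP.
Definition Y_beta : signing intpart := Signing s_betaP a'_signP.

(* Main.v *)
From mathcomp Require Import all_boot all_order all_algebra.
From mathcomp Require Import boolp classical_sets functions fsbigop.
From mathcomp Require Import zify ring.
Require Import Defs.

Set Implicit Arguments.
Unset Strict Implicit.
Unset Printing Implicit Defensive.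

Import GRing.Theory.

(** Write [S_k = l_0 + ... + l_(k-1)] for the sum of the first [k] rows of a
    partition [l] (rows and columns being numbered from 0), and [e_i] for a box
    in row [i].  Adding a box in row [i] of [l] puts it in column [l_i], so it
    multiplies [a'] by [(-1)^(l_i)].  Hence, in [Y_alpha], the coefficient of
    [D] from [l + e_i] to [l] is the sign of [S_(i+1) + l_i], that is of [S_i]:
    - [(U f)(l)] is the sum over the removable rows [i] of
      [- (-1)^(S_(i+1)) f(l - e_i)]   ([up_alphaE]);
    - [(D f)(l)] is the sum over the addable rows [j] of
      [(-1)^(S_j) f(l + e_j)]   ([down_alphaE]).

    In [(UD + DU) f] the value [f(l - e_i + e_j)] with [i <> j] occurs once in
    each product, as removing a box in row [i] and adding one in row [j]
    commute, including as to whether they are possible ([add_rem_box],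
    [add_rem_boxC]).  The two signs are opposite, because exactly one of the two
    moves changes the partial sum of rows used by the other
    ([move_signs_cancel]).  What remains is [f(l)] times the sum of
    [(-1)^(l_i)] over the addable rows minus the same sum over the removable
    rows.  Row [i.+1] is addable iff row [i] is removable, that is iff
    [l_(i+1) < l_i], so the difference is [(-1)^(l_0)] plus the sum of all
    [(-1)^(l_(i+1)) - (-1)^(l_i)], which telescopes to 1 ([corner_sign_sum]).

    The same pairing of addable row [i.+1] with removable row [i] settles
    [(U + D) P = P]: both have the sign of [S_(i+1)], with opposite
    coefficients, and the addable row 0 contributes 1.

    For [Y_beta], both operators are the conjugates of those of [Y_alpha] by
    the diagonal involution [a] ([up_beta_twist], [down_beta_twist]), which
    preserves the anticommutation relation.  In [(D - U) P] the twist adds a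
    factor [(-1)^i] for a box in row [i], which makes the paired terms cancel
    again now that [U] is subtracted. *)

Local Open Scope nat_scope.

(** * Adding and removing a box *)

Lemma part_ge_size (l : intpart) i : size l <= i -> part l i = 0.
Proof. by move=> le; rewrite /part nth_default. Qed.

Lemma intpart_of_rows (g : nat -> nat) (n : nat) :
  (forall i, g i.+1 <= g i) -> g n = 0 -> exists m : intpart, part m =1 g.
Proof.
move=> mono gn0; have ex0 : exists k, g k == 0 by exists n; rewrite gn0.
have [k /eqP gk0 mink] := ex_minnP ex0.
have g0 i : k <= i -> g i = 0.
  move=> /subnKC <-; elim: (i - k) => [|j IH]; first by rewrite addn0.
  by have := mono (k + j); rewrite addnS IH leqn0 => /eqP.
have gE i : part (mkseq g k) i = g i.
  have [lt|ge] := ltnP i k; first by rewrite /part nth_mkseq.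
  by rewrite g0 // /part nth_default ?size_mkseq.
have ip : is_intpart (mkseq g k).
  apply/is_intpartP; split=> i; rewrite ?size_mkseq ?gE //.
  by rewrite lt0n => ltik; apply/negP => /mink; lia.
by exists (IntPart ip).
Qed.

(** Specifying partitions by their row lengths spares [rem_box] the distinction
    whether the shortened row disappears from the list of parts. *)
Definition of_rows (g : nat -> nat) : intpart :=
  xget empty_intpart [set m : intpart | part m =1 g]%classic.

Lemma part_of_rows (g : nat -> nat) n :
  (forall i, g i.+1 <= g i) -> g n = 0 -> part (of_rows g) =1 g.
Proof.
by move=> mono gn0; have := xgetPex empty_intpart (intpart_of_rows mono gn0).
Qed.

Definition addable (l : intpart) (i : nat) : bool :=
  if i is k.+1 then part l k.+1 < part l k else true.

Definition removable (l : intpart) (i : nat) : bool := part l i.+1 < part l i.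

Definition add_box (l : intpart) (i : nat) : intpart :=
  of_rows (fun j => (i == j) + part l j).

Definition rem_box (l : intpart) (i : nat) : intpart :=
  of_rows (fun j => part l j - (i == j)).

Lemma part_add_box l i : addable l i ->
  part (add_box l i) =1 (fun j => (i == j) + part l j).
Proof.
move=> add; apply: (@part_of_rows _ (maxn (size l) i.+1)) => [j|].
  have := part_homo l (leqnSn j).
  case: (eqVneq i j.+1) => [ij|_]; last by case: (i == j); lia.
  by move: add; rewrite ij /=; case: (_ == j); lia.
by rewrite part_ge_size ?leq_maxl // addn0; case: eqP => // iE; lia.
Qed.

Lemma part_rem_box l i : removable l i ->
  part (rem_box l i) =1 (fun j => part l j - (i == j)).
Proof.
rewrite /removable => rem; apply: (@part_of_rows _ (size l)) => [j|].
  have := part_homo l (leqnSn j).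
  by case: (eqVneq i j) rem => [<-|_]; case: (i == _); lia.
by rewrite part_ge_size.
Qed.

Lemma rem_boxK l i : removable l i ->
  addable (rem_box l i) i /\ add_box (rem_box l i) i = l.
Proof.
move=> rem; have pE := part_rem_box rem.
have add : addable (rem_box l i) i.
  case: i rem pE => // i; rewrite /removable => rem pE; rewrite /addable !pE.
  by have := part_homo l (leqnSn i); lia.
split=> //; apply: intpart_eq => j; rewrite part_add_box // pE.
by move: rem; rewrite /removable; case: eqP => [<-|_]; lia.
Qed.

Lemma add_boxK l i : addable l i ->
  removable (add_box l i) i /\ rem_box (add_box l i) i = l.
Proof.
move=> add; have pE := part_add_box add.
have rem : removable (add_box l i) i.
  rewrite /removable !pE eqxx; have := part_homo l (leqnSn i).
  by case: eqP; lia.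
split=> //; apply: intpart_eq => j; rewrite part_rem_box // pE; lia.
Qed.

Lemma covers_partP (l m : intpart) :
  l ⋖ m <-> exists i, part m =1 (fun j => (i == j) + part l j).
Proof.
rewrite young_coversP; split=> [[i mE]|[i mE]]; exists i.
  by move=> j; rewrite mE part_incr.
have pE j : part (incr_nth l i) j = part m j by rewrite part_incr mE.
have ip : is_intpart (incr_nth l i).
  apply/is_intpartP; split=> k; rewrite !pE; first exact: part_homo.
  rewrite size_incr_nth; case: ifP => [_ ltk|/negbT]; rewrite ?mE.
    by have := part_gt0 l k; lia.
  rewrite -leqNgt => lei; rewrite ltnS => /(part_homo m).
  by rewrite !mE; lia.
by rewrite (intpart_eq (m := IntPart ip) (l := m)).
Qed.

Lemma covers_add_box l i : addable l i -> l ⋖ add_box l i.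
Proof. by move=> add; apply/covers_partP; exists i; apply: part_add_box. Qed.

Lemma covers_rem_box l i : removable l i -> rem_box l i ⋖ l.
Proof. by case/rem_boxK => /covers_add_box + lE; rewrite lE. Qed.

Lemma covers_addP l m : l ⋖ m <-> exists2 i, addable l i & m = add_box l i.
Proof.
split=> [/covers_partP[i mE]|[i add ->]]; last exact: covers_add_box.
have add : addable l i.
  case: i mE => // i mE; have := part_homo m (leqnSn i).
  by rewrite /addable !mE; lia.
by exists i => //; apply: intpart_eq => j; rewrite part_add_box.
Qed.

Lemma covers_remP l m : l ⋖ m <-> exists2 i, removable m i & l = rem_box m i.
Proof.
split=> [/covers_addP[i add ->]|[i rem ->]]; last exact: covers_rem_box.
by have [rem lE] := add_boxK add; exists i.
Qed.

Lemma added_row_add_box l i : addable l i -> added_row l (add_box l i) = i.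
Proof.
move=> add; have /covers_added_row mE := covers_add_box add.
have := part_add_box add i; rewrite mE part_incr eqxx.
by case: eqP => //; lia.
Qed.

Lemma removable_size l i : removable l i -> i < size l.
Proof. by rewrite /removable -part_gt0; apply: leq_trans. Qed.

Lemma addable_size l i : addable l i -> i <= size l.
Proof. by case: i => //= i /removable_size. Qed.

Lemma size_add_box l i : addable l i -> size (add_box l i) <= (size l).+1.
Proof.
move=> add; rewrite leqNgt; apply/negP; rewrite -part_gt0 part_add_box //.
have := addable_size add; rewrite part_ge_size //; lia.
Qed.

Lemma size_rem_box l i : removable l i -> size (rem_box l i) <= size l.
Proof.
move=> rem; rewrite leqNgt; apply/negP; rewrite -part_gt0 part_rem_box //.
by rewrite part_ge_size.
Qed.

Lemma add_box_inj l i j : addable l i -> addable l j ->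
  add_box l i = add_box l j -> i = j.
Proof.
move=> ai aj eq_add.
by rewrite -(added_row_add_box ai) eq_add added_row_add_box.
Qed.

Lemma rem_box_inj l i j : removable l i -> removable l j ->
  rem_box l i = rem_box l j -> i = j.
Proof.
move=> ri rj eq_rem; have [ai li] := rem_boxK ri; have [aj lj] := rem_boxK rj.
move: aj lj; rewrite -eq_rem => aj lj.
by apply: (add_box_inj ai aj); rewrite li lj.
Qed.

(** Row [i] only looks at rows [i] and [i.+1], and row [j] at rows [j] and
    [j.-1].  They interact only for [j = i.+1], where both sides say that [l_i]
    exceeds [l_(i+1)] by at least 2. *)
Lemma add_rem_box (l : intpart) (i j : nat) : i != j ->
  removable l i && addable (rem_box l i) j =
  addable l j && removable (add_box l j) i.
Proof.
move=> neq; apply/andP/andP => -[].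
  move=> rem add; have pE := part_rem_box rem.
  move: rem; rewrite /removable => rem.
  have addj : addable l j.
    by case: j neq add => // j neq; rewrite /addable !pE; lia.
  split=> //; rewrite !(part_add_box addj).
  have [jE|] := eqVneq j i.+1; last by lia.
  by move: add; rewrite jE /addable !pE; lia.
move=> add; have pE := part_add_box add; rewrite /removable !pE => rem.
have remi : part l i.+1 < part l i by lia.
split=> //; have qE := part_rem_box remi.
have [jE|ne] := eqVneq j i.+1; first by move: rem; rewrite jE /addable !qE; lia.
by case: j neq ne add {pE rem} => // j neq ne; rewrite /addable !qE; lia.
Qed.

Lemma add_rem_boxC (l : intpart) (i j : nat) :
    i != j -> removable l i -> addable (rem_box l i) j ->
  add_box (rem_box l i) j = rem_box (add_box l j) i.
Proof.
move=> neq rem add; have := add_rem_box l neq; rewrite rem add /=.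
move=> /esym/andP[addj remi]; apply: intpart_eq => k.
rewrite part_add_box // part_rem_box // part_rem_box // part_add_box //.
by lia.
Qed.

Local Open Scope ring_scope.

(** * The effect of a box on the signs *)

Lemma a_signE (l : intpart) n : (size l <= n)%N ->
  a_sign l = (-1) ^+ (\sum_(i < n | odd i) part l i)%N.
Proof.
move=> le; rewrite /a_sign (big_ord_widen_cond _ _ (part l) le).
congr (_ ^+ _); rewrite [RHS](bigID (fun i : 'I_n => (i < size l)%N)) /=.
rewrite [X in (_ + X)%N]big1 ?addn0 // => i /andP[_].
by rewrite -leqNgt => /part_ge_size.
Qed.

(** Stated on row lengths so that it also applies to conjugate partitions, where
    the rank of the enlarged row is the column of the added box. *)
Lemma a_sign_incr (l m : intpart) (i : nat) :
  part m =1 (fun j => (i == j) + part l j)%N -> a_sign m = (-1) ^+ i * a_sign l.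
Proof.
move=> mE; pose n := maxn (maxn (size l) (size m)) i.+1.
rewrite (@a_signE m n) ?(@a_signE l n) /n ?leq_max ?leqnn ?orbT // -/n.
rewrite (eq_bigr _ (fun (j : 'I_n) _ => mE j)) big_split /= exprD.
congr (_ * _).
have lt : (i < n)%N by rewrite /n leq_max leqnn orbT.
rewrite -[RHS]signr_odd; case: (boolP (odd i)) => oi.
  rewrite (bigD1 (Ordinal lt)) //= eqxx big1 // => j /andP[_].
  by rewrite -val_eqE /= eq_sym => /negPf ->.
by rewrite big1 // => j oj; case: eqP => // ij; move: oi; rewrite ij oj.
Qed.

Lemma count_incr (s : seq nat) i j :
  count (ltn j) (incr_nth s i) = ((part s i == j) + count (ltn j) s)%N.
Proof.
elim: s i => [|x s IH] [|i] /=; rewrite /part /= ?nth_nil.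
- by case: j.
- by elim: i => [|i IHi] /=; [case: j|rewrite IHi].
- by lia.
- by rewrite IH /part addnCA.
Qed.

Lemma part_conj_add_box (l : intpart) i : addable l i ->
  part (conjugate (add_box l i)) =1
    (fun j => (part l i == j) + part (conjugate l) j)%N.
Proof.
move=> add j; rewrite !part_conj.
rewrite (covers_added_row (covers_add_box add)) added_row_add_box //.
exact: count_incr.
Qed.

Lemma a'_sign_add_box (l : intpart) i : addable l i ->
  a'_sign (add_box l i) = (-1) ^+ part l i * a'_sign l.
Proof. by move=> add; apply/a_sign_incr/part_conj_add_box. Qed.

Lemma a_sign_add_box (l : intpart) i : addable l i ->
  a_sign (add_box l i) = (-1) ^+ i * a_sign l.
Proof. by move=> add; apply/a_sign_incr/part_add_box. Qed.

Lemma a_sign_rem_box (l : intpart) i : removable l i ->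
  a_sign (rem_box l i) = (-1) ^+ i * a_sign l.
Proof.
move=> /rem_boxK[add {2}<-]; rewrite a_sign_add_box // mulrA -expr2.
by rewrite sqrr_sign mul1r.
Qed.

Definition row_sum (l : intpart) (i : nat) : nat := (\sum_(j < i) part l j)%N.

Lemma row_sumS l i : row_sum l i.+1 = (row_sum l i + part l i)%N.
Proof. by rewrite /row_sum big_ord_recr. Qed.

Lemma row_sum_add_box (l : intpart) (i k : nat) : addable l i ->
  row_sum (add_box l i) k = ((i < k)%N + row_sum l k)%N.
Proof.
move=> add; elim: k => [|k IH]; first by rewrite /row_sum !big_ord0.
by rewrite !row_sumS IH part_add_box //; lia.
Qed.

Lemma row_sum_rem_box (l : intpart) (i k : nat) : removable l i ->
  row_sum l k = ((i < k)%N + row_sum (rem_box l i) k)%N.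
Proof. by move=> /rem_boxK[add {1}<-]; rewrite row_sum_add_box. Qed.

Lemma s_alpha_add_box (l : intpart) i : addable l i ->
  s_alpha l (add_box l i) = (-1) ^+ row_sum l i.+1.
Proof. by move=> add; rewrite /s_alpha added_row_add_box. Qed.

(** * The operators as sums over rows *)

(** A bound [n] on the indices, rather than the exact set [b], lets one range
    serve for several partitions at once. *)
Lemma infcomb_image (K : fieldType) d (P : gradedPosetType d) (I : choiceType)
    (f : I -> K) (B : I -> P -> K) (z : P) (b : pred nat) (h : nat -> I) n :
    {in b &, injective h} -> (forall i, b i -> (i < n)%N) ->
    (forall x, B x z != 0 -> exists2 i, b i & x = h i) ->
  infcomb (K := K) f B z = \sum_(0 <= i < n | b i) f (h i) * B (h i) z :> K.
Proof.
move=> h_inj b_lt suppB; rewrite /infcomb.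
pose r := [seq h i | i <- iota 0 n & b i].
have uniq_r : uniq r.
  rewrite map_inj_in_uniq ?filter_uniq ?iota_uniq // => i j.
  by rewrite !mem_filter => /andP[bi _] /andP[bj _]; apply: h_inj.
rewrite -(@fsbig_widen _ _ _ _ [set` r]) //; last first.
  move=> x [_ /= /negP rx]; apply/eqP; rewrite mulf_eq0; apply/orP; right.
  apply: contraNT rx => /suppB[i bi ->]; apply: map_f.
  by rewrite mem_filter bi mem_iota add0n b_lt.
by rewrite -fsbig_seq //= big_map big_filter /index_iota subn0.
Qed.

Section Operators.
Variables (K : fieldType) (S : signing intpart).
Implicit Types (f : intpart -> K) (l : intpart).

Lemma up_rowE f l n : (size l <= n)%N -> up S f l =
  \sum_(0 <= i < n | removable l i)
    f (rem_box l i) * (sgn_cover S (rem_box l i) l)%:~R :> K.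
Proof.
move=> len; rewrite /up
  (@infcomb_image _ _ _ _ _ _ _ (removable l) (rem_box l) n).
- apply: eq_bigr => i rem; rewrite up_basisE; case: asboolP => // -[].
  exact: covers_rem_box.
- by move=> i j; apply: rem_box_inj.
- by move=> i /removable_size lt; apply: leq_trans len.
- move=> x; rewrite up_basisE.
  by case: asboolP; rewrite ?eqxx // => /covers_remP.
Qed.

Lemma down_rowE f l n : (size l < n)%N -> down S f l =
  \sum_(0 <= i < n | addable l i) f (add_box l i) *
    (sgn_cover S l (add_box l i) * sgn_elt S (add_box l i) * sgn_elt S l)%:~R
  :> K.
Proof.
move=> ltn; rewrite /down
  (@infcomb_image _ _ _ _ _ _ _ (addable l) (add_box l) n).
- apply: eq_bigr => i add; rewrite down_basisE; case: asboolP => // -[].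
  exact: covers_add_box.
- by move=> i j; apply: add_box_inj.
- by move=> i /addable_size le; apply: leq_ltn_trans ltn.
- move=> x; rewrite down_basisE.
  by case: asboolP; rewrite ?eqxx // => /covers_addP.
Qed.

End Operators.

(** * Sums over corners *)

(** Row [i.+1] is addable iff row [i] is removable, both by definition. *)
Lemma sum_addable (V : nmodType) (F : nat -> V) (l : intpart) n :
  \sum_(0 <= i < n.+1 | addable l i) F i =
  F 0%N + \sum_(0 <= i < n | removable l i) F i.+1.
Proof. by rewrite big_mkcond big_nat_recl // -big_mkcond. Qed.

Lemma sum_removableS (V : nmodType) (F : nat -> V) (l : intpart) n :
    (size l <= n)%N ->
  \sum_(0 <= i < n.+1 | removable l i) F i =
  \sum_(0 <= i < n | removable l i) F i.
Proof.
move=> le; rewrite big_mkcond big_nat_recr // -big_mkcond /=.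
case: ifP => [/removable_size|_]; last exact: addr0.
by rewrite ltnNge le.
Qed.

Lemma corner_sign_sum (R : pzRingType) (l : intpart) n : (size l <= n)%N ->
  \sum_(0 <= i < n.+1 | addable l i) (-1) ^+ part l i
  - \sum_(0 <= i < n.+1 | removable l i) (-1) ^+ part l i = 1 :> R.
Proof.
move=> le; rewrite sum_addable sum_removableS // -addrA -sumrB.
(* The rows that are not removable contribute 0 to the telescoping sum. *)
rewrite big_mkcond (eq_bigr (fun i => (-1) ^+ part l i.+1 - (-1) ^+ part l i)).
  by rewrite telescope_sumr // addrC subrK part_ge_size.
move=> i _; rewrite /removable; case: ltnP => // ge.
have -> : part l i.+1 = part l i by apply/eqP; rewrite eqn_leq part_homo.
by rewrite subrr.
Qed.

Lemma sum_nest (R : pzSemiRingType) n (c : nat -> R) (P : pred nat)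
    (Q : nat -> pred nat) (d : nat -> nat -> R) :
  \sum_(0 <= i < n | P i) c i * (\sum_(0 <= j < n | Q i j) d i j) =
  \sum_(i < n) \sum_(j < n) (if P i && Q i j then c i * d i j else 0).
Proof.
rewrite big_mkord big_mkcond; apply: eq_bigr => i _.
by case: (P i) => /=; [rewrite big_mkord mulr_sumr big_mkcond | rewrite big1].
Qed.

(** * The alpha signing *)

(** Either [i < j], and removing a box from row [i] shortens the rows above row
    [j], or [j <= i], and adding a box to row [j] lengthens the rows up to row
    [i]: exactly one of the two moves changes the sign of the other. *)
Lemma move_signs_cancel (R : pzRingType) (l : intpart) (i j : nat) :
    removable l i -> addable l j ->
  (-1) ^+ (row_sum l i.+1 + row_sum (rem_box l i) j) +
  (-1) ^+ (row_sum l j + row_sum (add_box l j) i.+1) = 0 :> R.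
Proof.
move=> rem add; rewrite row_sum_add_box // (row_sum_rem_box j rem).
have -> : (-1) ^+ (row_sum l i.+1 + row_sum (rem_box l i) j) =
    - (-1) ^+ ((i < j) + row_sum (rem_box l i) j
               + ((j < i.+1) + row_sum l i.+1))%N :> R.
  rewrite -[- (_ ^+ _)]mulN1r -exprS -signr_odd -[in RHS]signr_odd.
  by congr ((-1) ^+ nat_of_bool _); lia.
by rewrite addNr.
Qed.

(** In the diagonal terms the two partial sums differ by row [i] only; the added
    box, counted in one of them, accounts for the minus. *)
Lemma add_rem_sign (R : pzRingType) (l : intpart) i : addable l i ->
  - (-1) ^+ (row_sum l i + row_sum (add_box l i) i.+1) = (-1) ^+ part l i :> R.
Proof.
move=> add; rewrite row_sum_add_box // ltnSn row_sumS.
rewrite -[- (_ ^+ _)]mulN1r -exprS -signr_odd -[in RHS]signr_odd.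
by congr ((-1) ^+ nat_of_bool _); lia.
Qed.

Lemma rem_add_sign (R : pzRingType) (l : intpart) i : removable l i ->
  (-1) ^+ (row_sum l i.+1 + row_sum (rem_box l i) i) = (-1) ^+ part l i :> R.
Proof.
move=> rem; rewrite row_sumS (@row_sum_rem_box l i i) // ltnn.
by rewrite -signr_odd -[in RHS]signr_odd; congr ((-1) ^+ nat_of_bool _); lia.
Qed.

Section Alpha.
Variable K : fieldType.
Implicit Types (f : intpart -> K) (l : intpart).

(** The sign is that of the first [i.+1] rows of [rem_box l i], one box short of
    those of [l]; whence the global minus. *)
Lemma up_alphaE f l n : (size l <= n)%N -> up Y_alpha f l =
  - \sum_(0 <= i < n | removable l i) (-1) ^+ row_sum l i.+1 * f (rem_box l i)
  :> K.
Proof.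
move=> len; rewrite (up_rowE _ _ len) -sumrN; apply: eq_bigr => i rem /=.
have [add lE] := rem_boxK rem.
rewrite -[X in s_alpha _ X]lE s_alpha_add_box // rmorphXn rmorphN1 /=.
by rewrite (row_sum_rem_box _ rem) ltnSn exprS mulN1r mulNr opprK mulrC.
Qed.

(** The factor [(-1) ^+ part l i] from [a'] takes row [i] out of the sign of
    the cover. *)
Lemma down_alphaE f l n : (size l < n)%N -> down Y_alpha f l =
  \sum_(0 <= i < n | addable l i) (-1) ^+ row_sum l i * f (add_box l i) :> K.
Proof.
move=> ltn; rewrite (down_rowE _ _ ltn); apply: eq_bigr => i add /=.
rewrite s_alpha_add_box // a'_sign_add_box // mulrC; congr (_ * _).
have -> : (-1) ^+ row_sum l i.+1 * ((-1) ^+ part l i * a'_sign l) * a'_sign l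
          = (-1) ^+ row_sum l i :> int.
  rewrite row_sumS exprD -!mulrA; case: (a'_signP l) => ->;
    by rewrite ?mulrNN !mulr1 -expr2 sqrr_sign mulr1.
by rewrite rmorphXn rmorphN1.
Qed.

Lemma alpha_anticommutation f :
  up Y_alpha (down Y_alpha f) + down Y_alpha (up Y_alpha f) = f.
Proof.
apply/funext => l.
change (up Y_alpha (down Y_alpha f) l + down Y_alpha (up Y_alpha f) l
        = f l :> K).
pose n := (size l).+1.
have ltn : (size l < n)%N by rewrite /n.
rewrite (up_alphaE _ (ltnW ltn)) (down_alphaE _ ltn).
have -> : \sum_(0 <= i < n | removable l i)
      (-1) ^+ row_sum l i.+1 * down Y_alpha f (rem_box l i) =
    \sum_(i < n) \sum_(j < n)
      if removable l i && addable (rem_box l i) j then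
      (-1) ^+ row_sum l i.+1 * ((-1) ^+ row_sum (rem_box l i) j *
         f (add_box (rem_box l i) j)) else 0 :> K.
  rewrite -(sum_nest _ (fun i => (-1) ^+ row_sum l i.+1) _
    (fun i => addable (rem_box l i))
    (fun i j => (-1) ^+ row_sum (rem_box l i) j * f (add_box (rem_box l i) j))).
  apply: eq_bigr => i rem; rewrite (@down_alphaE _ _ n) //.
  by apply: leq_ltn_trans (size_rem_box rem) _.
have -> : \sum_(0 <= j < n | addable l j)
      (-1) ^+ row_sum l j * up Y_alpha f (add_box l j) =
    - \sum_(j < n) \sum_(i < n)
      if addable l j && removable (add_box l j) i then
      (-1) ^+ row_sum l j * ((-1) ^+ row_sum (add_box l j) i.+1 *
         f (rem_box (add_box l j) i)) else 0 :> K.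
  rewrite -(sum_nest _ (fun j => (-1) ^+ row_sum l j) _
    (fun j => removable (add_box l j))
    (fun j i => (-1) ^+ row_sum (add_box l j) i.+1 *
                f (rem_box (add_box l j) i))).
  rewrite -sumrN; apply: eq_bigr => j add; rewrite (@up_alphaE _ _ n) ?mulrN //.
  exact: leq_trans (size_add_box add) _.
rewrite [X in _ - X]exchange_big /= -opprD -big_split /= -sumrN.
transitivity (\sum_(i < n)
    ((if addable l i then (-1) ^+ part l i else 0)
     - (if removable l i then (-1) ^+ part l i else 0)) * f l).
  apply: eq_bigr => i _; rewrite -big_split (bigD1 i) //= big1 ?addr0.
    rewrite opprD addrC mulrBl; congr (_ + _).
      case: (boolP (addable l i)) => [add|_]; last by rewrite mul0r oppr0.
      have [rem ->] := add_boxK add; rewrite rem /=.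
      by rewrite mulrA -exprD -mulNr add_rem_sign.
    case: (boolP (removable l i)) => [rem|_]; last by rewrite mul0r.
    have [add ->] := rem_boxK rem; rewrite add /=.
    by rewrite mulrA -exprD rem_add_sign.
  move=> j /negPf ne_ji.
  have ne : (i != j :> nat) by rewrite eq_sym; apply/negbT.
  rewrite -add_rem_box //; case: ifP => [/andP[rem add]|_]; last exact: addr0.
  have := add_rem_box l ne; rewrite rem add => /esym/andP[addj _].
  rewrite add_rem_boxC // !mulrA -!exprD -mulrDl.
  by rewrite move_signs_cancel // mul0r.
rewrite -mulr_suml big_split /= sumrN.
rewrite -!(big_mkord xpredT (fun i => if _ i then (-1) ^+ part l i else 0)).
by rewrite -!big_mkcond corner_sign_sum // mul1r.
Qed.

Lemma alpha_allsum :
  up Y_alpha (allsum K intpart) + down Y_alpha (allsum K intpart)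
  = allsum K intpart.
Proof.
apply/funext => l.
change (up Y_alpha (allsum K intpart) l + down Y_alpha (allsum K intpart) l
        = 1 :> K).
rewrite (up_alphaE _ (leqnn _)) (down_alphaE _ (ltnSn _)) sum_addable.
rewrite /row_sum big_ord0 mulr1 -sumrN addrCA -big_split /=.
by rewrite big1 ?addr0 // => i _; rewrite !mulr1 addNr.
Qed.

End Alpha.

(** * The beta signing *)

Section Beta.
Variable K : fieldType.
Implicit Types (f : intpart -> K) (l : intpart).

Definition a_twist f : hat K intpart := fun l => (a_sign l)%:~R * f l.

Lemma a_sign_sqr l : a_sign l * a_sign l = 1.
Proof. by rewrite -expr2 sqrr_sign. Qed.

Lemma a_twistK : involutive a_twist.
Proof.
by move=> f; apply/funext => l; rewrite /a_twist mulrA -intrM a_sign_sqr mul1r.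
Qed.

Lemma up_beta_twist f : up Y_beta f = a_twist (up Y_alpha (a_twist f)).
Proof.
apply/funext => l; rewrite /a_twist !(up_rowE _ _ (leqnn _)) mulr_sumr.
apply: eq_bigr => i _ /=; rewrite /s_beta !intrM.
by ring.
Qed.

Lemma down_beta_twist f : down Y_beta f = a_twist (down Y_alpha (a_twist f)).
Proof.
apply/funext => l; rewrite /a_twist !(down_rowE _ _ (ltnSn _)) mulr_sumr.
apply: eq_bigr => i _ /=; rewrite /s_beta !intrM.
by ring.
Qed.

Lemma beta_anticommutation f :
  up Y_beta (down Y_beta f) + down Y_beta (up Y_beta f) = f.
Proof.
rewrite !up_beta_twist !down_beta_twist !a_twistK.
rewrite -[RHS]a_twistK -[in RHS](alpha_anticommutation (a_twist f)).
by apply/funext => l; rewrite /a_twist [RHS]mulrDr.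
Qed.

Lemma beta_allsum :
  down Y_beta (allsum K intpart) - up Y_beta (allsum K intpart)
  = allsum K intpart.
Proof.
apply/funext => l.
change (down Y_beta (allsum K intpart) l - up Y_beta (allsum K intpart) l
        = 1 :> K).
rewrite up_beta_twist down_beta_twist.
rewrite {1 3}/a_twist (up_alphaE _ (leqnn _)) (down_alphaE _ (ltnSn _)).
rewrite mulrN opprK -mulrDr sum_addable -addrA -big_split /= big1 => [|i rem].
  rewrite addr0 /row_sum big_ord0 mul1r /a_twist mulr1 -intrM.
  by rewrite a_sign_add_box // mul1r a_sign_sqr.
rewrite -mulrDr /a_twist !mulr1 -intrD.
rewrite a_sign_rem_box // (@a_sign_add_box l i.+1) //.
by rewrite exprS mulN1r mulNr addNr mulr0.
Qed.

End Beta.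

Theorem theorem4p2 (K : fieldType) (charK0 : [pchar K]%R =i pred0) :
  alpha_signed_differential K Y_alpha /\ beta_signed_differential K Y_beta.
Proof.
have v0 : a'_sign \bot%O = 1 by rewrite /a'_sign /a_sign big_ord0.
split; (split; first split=> //).
- exact: alpha_anticommutation.
- exact: alpha_allsum.
- exact: beta_anticommutation.
- exact: beta_allsum.
Qed.
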